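(* Let $G$ be a connected graph on $n+1$ vertices with $n\geq 2$, let $\mathcal{R}(G)$ be the rotation graph of $G$ (which is an $n$-regular graph), and let $\lambda_2$ be the second largest eigenvalue of the adjacency matrix of $\mathcal{R}(G)$. Then $\lambda_2\geq n-2$.
   Context: Graphs are finite, simple and undirected. A search tree $T$ on a connected graph $G$ is a rooted tree with vertex set $V(G)$, defined recursively: the root of $T$ is a chosen vertex $r\in V(G)$, and the children of $r$ are the roots of search trees on each of the connected components of $G-r$. Let $T$ be a search tree on $G$ and let $v$ be a child of $u$ in $T$. The $uv$-rotation transforms $T$ into the search tree $T'$ on $G$ such that: (i) $u$ is a child of $v$ in $T'$; if $u$ is the root of $T$ then $v$ is the root of $T'$, otherwise, if $p$ is the parent of $u$ in $T$, then $p$ is the parent of $v$ in $T'$; (ii) every subtree of $u$ in $T$ other than the one rooted at $v$ remains a subtree of $u$ in $T'$; (iii) each subtree $S$ of $v$ in $T$ becomes a subtree of $u$ in $T'$ if $u$ is adjacent in $G$ to some vertex of $S$, and otherwise remains a subtree of $v$. All other parent-child relations are unchanged. The rotation graph $\mathcal{R}(G)$ is the undirected graph whose vertices are the search trees on $G$, two search trees being adjacent if one is obtained from the other by a single rotation. If $G$ has $n+1$ vertices, $\mathcal{R}(G)$ is $n$-regular. Eigenvalues $\lambda_1\geq\lambda_2\geq\dots$ of the adjacency matrix are listed with multiplicity. *)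

(* Defs.v *)
From HB Require Import structures.
From mathcomp Require Import all_boot all_order all_algebra.
From mathcomp Require Import complex polyrcf.

Set Implicit Arguments.
Unset Strict Implicit.
Unset Printing Implicit Defensive.

Import Order.TTheory GRing.Theory Num.Theory.

Section SearchTrees.

Variables (V : finType) (e : rel V).

Definition induced (S : {set V}) : rel V :=
  [rel x y | [&& x \in S, y \in S & e x y]].

Definition components (S : {set V}) : {set {set V}} :=
  [set [set y in S | connect (induced S) x y] | x in S].

(* A rooted tree with vertex set V is encoded by its parent function p:       *)
(* p x = None if x is the root, and p x = Some y if y is the parent of x.     *)
Definition parent_fun := {ffun V -> option V}.

(* p restricts, below r, to a search tree with root r on the subgraph induced *)
(* by S.  The parent of r itself is left unconstrained.  The fuel k bounds    *)
(* the recursion depth; any k >= #|S| gives the same value, since components  *)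
(* of S :\ r have fewer than #|S| vertices.                                   *)
Fixpoint search_tree_on (p : parent_fun) (k : nat) (S : {set V}) (r : V) :
    bool :=
  if k is k'.+1 then
    (r \in S) && [forall C in components (S :\ r),
      [exists c, (p c == Some r) && search_tree_on p k' C c]]
  else false.

Definition is_search_tree (p : parent_fun) : bool :=
  [exists r, (p r == None) && search_tree_on p #|V| [set: V] r].

Definition search_tree := {p : parent_fun | is_search_tree p}.

HB.instance Definition _ := Finite.on search_tree.

Definition subtree (p : parent_fun) (w : V) : {set V} :=
  [set x | connect [rel a b | p a == Some b] x w].

(* The uv-rotation, meaningful when v is a child of u, i.e. p v = Some u.     *)
Definition rotate (p : parent_fun) (u v : V) : parent_fun :=
  [ffun w =>
     if w == v then p u
     else if w == u then Some v
     else if (p w == Some v) && [exists x in subtree p w, e u x] then Some u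
     else p w].

Definition rotates_to (T T' : search_tree) : bool :=
  [exists u, exists v,
     (val T v == Some u) && (val T' == rotate (val T) u v)].

Definition rotation_graph : rel search_tree :=
  [rel T T' | rotates_to T T' || rotates_to T' T].

End SearchTrees.

Arguments rotation_graph {V} e.

Local Open Scope ring_scope.

Definition adjacency_mx (R : pzRingType) (T : finType) (e : rel T) :
    'M[R]_#|T| :=
  \matrix_(i, j) (e (enum_val i) (enum_val j))%:R.

(* The roots in R of the characteristic polynomial of A, in nonincreasing     *)
(* order, each repeated according to its multiplicity.  Indices start at 0,   *)
(* so that the k-th largest eigenvalue is (eigenvalues A)`_k.-1.  When A is   *)
(* symmetric no eigenvalue is lost: see eigenvaluesP.                         *)
Definition eigenvalues (R : rcfType) (n : nat) (A : 'M[R]_n) : seq R :=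
  sort >=%R
    (flatten [seq nseq (mup x (char_poly A)) x | x <- rootsR (char_poly A)]).

Lemma char_poly_conj (C : comUnitRingType) (n : nat) (P D : 'M[C]_n) :
  P \in unitmx -> char_poly (invmx P *m D *m P) = char_poly D.
Proof.
move=> Punit; rewrite /char_poly.
have -> : char_poly_mx (invmx P *m D *m P) =
    map_mx polyC (invmx P) *m char_poly_mx D *m map_mx polyC P.
  rewrite /char_poly_mx mulmxBr mulmxBl !map_mxM /=; congr (_ - _).
  by rewrite scalar_mxC -mulmxA -map_mxM mulVmx // map_mx1 mulmx1.
rewrite !det_mulmx mulrAC -det_mulmx -map_mxM mulVmx //.
by rewrite map_mx1 det1 mul1r.
Qed.

Lemma symmetric_char_poly_split (R : rcfType) (n : nat) (A : 'M[R]_n) :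
  A^T = A -> exists s : seq R, char_poly A = \prod_(x <- s) ('X - x%:P).
Proof.
move=> Asym; pose f := real_complex R; pose B := map_mx f A.
have Bherm : B \is hermsymmx.
  apply/is_hermitianmxP; rewrite expr0 scale1r; apply/matrixP => i j.
  rewrite !mxE -[in LHS]Asym mxE; apply/esym/CrealP.
  by rewrite complex_real.
have dreal := hermitian_spectral_diag_real Bherm.
have /orthomx_spectralP Bspec := hermitian_normalmx Bherm.
have cpB : char_poly B = \prod_(i < n) ('X - (spectral_diag B 0 i)%:P).
  rewrite {1}Bspec char_poly_conj ?spectral_unit // char_poly_trig.
    by apply: eq_bigr => i _; rewrite mxE eqxx mulr1n.
  exact/diag_mx_is_trig.
exists [seq complex.Re (spectral_diag B 0 i) | i <- enum 'I_n].
apply: (map_poly_inj f); rewrite map_char_poly -/B cpB rmorph_prod /=.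
rewrite big_map big_enum /=; apply: eq_bigr => i _.
rewrite rmorphB /= map_polyX map_polyC /=; congr (_ - _%:P).
have /mxOverP /(_ 0 i) /complex_realP [x ->] := dreal.
by [].
Qed.

Lemma count_eigenvalues (R : rcfType) (n : nat) (A : 'M[R]_n) (x : R) :
  count_mem x (eigenvalues A) = mup x (char_poly A).
Proof.
have p0 : char_poly A != 0 by rewrite monic_neq0 ?char_poly_monic.
rewrite /eigenvalues count_sort count_flatten -map_comp.
set r := rootsR _; have r_uniq : uniq r by apply: uniq_roots.
have -> : mup x (char_poly A) = ((x \in r) * mup x (char_poly A))%N.
  rewrite -(roots_on_rootsR p0 x) /=; case: (boolP (root _ x)) => [_|/mupNroot ->].
    by rewrite mul1n.
  by [].
elim: r r_uniq => //= y r IH /andP[yr /IH ->].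
rewrite count_nseq /= in_cons; case: (eqVneq x y) => [->|_] //.
by rewrite (negPf yr) mul0n addn0 mul1n.
Qed.

Lemma eigenvaluesP (R : rcfType) (n : nat) (A : 'M[R]_n) : A^T = A ->
  sorted >=%R (eigenvalues A) /\
  char_poly A = \prod_(x <- eigenvalues A) ('X - x%:P).
Proof.
move=> /symmetric_char_poly_split[s cpA]; split.
  by apply: sort_sorted => x y; apply: le_total.
rewrite [LHS]cpA; apply/perm_big/allP => x _ /=.
by rewrite count_eigenvalues cpA mu_prod_XsubC.
Qed.

(* Main.v *)
Require Import Defs.
From mathcomp Require Import all_boot all_order all_algebra.
From mathcomp Require Import perm complex polyrcf ring lra.

(** Let a be a vertex such that G - a is connected.  A search tree rooted at
    a has a single child of the root, so all but one of its n rotations keep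
    a as the root: the set X_a of the search trees rooted at a induces in the
    rotation graph a subgraph of minimum degree at least n - 1
    ([inner_degree]).  A connected graph has two such vertices a and b
    ([noncut_search_rooted]), and X_a and X_b are nonempty and disjoint.  A
    tree of X_a has at most one neighbour in X_b, because the only way to pass
    from root a to root b by one rotation is to exchange the names a and b in
    the whole tree ([cross_degree]).

    On the plane spanned by the indicators of X_a and X_b the quadratic form
    of the adjacency matrix is therefore at least n - 2 times the squared
    norm: the edges inside the two sets contribute at least n - 1, and each
    vertex meets at most one cross edge, on which 2xy >= - (x^2 + y^2)
    ([cluster_form]).  By the Courant-Fischer principle ([courant_fischer]),
    two eigenvalues are at least n - 2.

    The degree bound requires that rotating a search tree yields a search
    tree.  The recursive description is awkward for this, so search trees are
    first characterized without recursion ([search_rootedP]): they are the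
    rooted trees in which the ends of each edge of G are comparable, and in
    which each nonroot vertex has in its subtree a neighbour of its parent.
    These conditions can be checked on a rotated tree because a rotation
    changes only the subtrees of the two vertices involved
    ([rotate_search_rooted]). *)

Set Implicit Arguments.
Unset Strict Implicit.
Unset Printing Implicit Defensive.

Import Order.TTheory GRing.Theory Num.Theory.

(** * Ancestors in a parent function *)

Section ParentFunctions.

Variable V : finType.
Implicit Types (p : parent_fun V) (a b r x y z w : V).

(** [under p x w]: [w] is [x] or an ancestor of [x].  It is the relation that
    defines [subtree], see [mem_subtree]. *)
Definition under p : rel V := connect [rel a b | p a == Some b].

Lemma under_refl p x : under p x x.
Proof. exact: connect0. Qed.

Lemma under_trans p : transitive (under p).
Proof. exact: connect_trans. Qed.

Lemma under_parent p x y : p x = Some y -> under p x y.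
Proof. by move=> pxy; apply: connect1; rewrite /= pxy. Qed.

Lemma mem_subtree p x w : (x \in subtree p w) = under p x w.
Proof. by rewrite inE. Qed.

(** Induction down the subtree of [w], from parents to children. *)
Lemma under_ind p w (P : V -> Prop) :
    P w -> (forall x y, p x = Some y -> under p y w -> P y -> P x) ->
  forall x, under p x w -> P x.
Proof.
move=> Pw IH x /connectP[s]; elim: s x => [|y s IHs] x /=; first by move=> _ <-.
case/andP=> /eqP pxy sP def_w; apply: (IH x y pxy) => //; last exact: IHs.
by apply/connectP; exists s.
Qed.

Lemma under_first p x w :
  under p x w -> x = w \/ exists2 y, p x = Some y & under p y w.
Proof.
by move: x; apply: under_ind => [|x y pxy yw _]; [left | right; exists y].
Qed.

Lemma under_last p x w :
  under p x w -> x = w \/ exists2 c, p c = Some w & under p x c.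
Proof.
move: x; apply: under_ind => [|x y pxy _ [yw | [c pc yc]]]; first by left.
  by right; exists x; rewrite ?under_refl // pxy yw.
by right; exists c => //; apply: under_trans (under_parent pxy) yc.
Qed.

(** The ancestors of [x] form a chain, as the parent of a vertex is unique. *)
Lemma under_linear p x y z : under p x y -> under p x z -> under p y z || under p z y.
Proof.
move=> xy xz; move: x xy xz; apply: under_ind => [|x x' pxx' x'y IH] xz.
  by rewrite xz.
case: (under_first xz) => [<- | [x'' pxx'']].
  by rewrite (under_trans (under_parent pxx') x'y) orbT.
by move: pxx''; rewrite pxx' => -[<-] /IH.
Qed.

Definition rooted p r := p r = None /\ forall x, under p x r.

(** From a vertex on a cycle one never leaves the cycle, while the root, which
    lies on no cycle, is reached from everywhere. *)
Lemma rooted_acyclic p r a b : rooted p r -> p a = Some b -> ~~ under p b a.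
Proof.
case=> pr reach pab; apply/negP => ba.
have back y : under p y r -> under p y a -> under p r a.
  move: y; apply: under_ind => // x y pxy _ IH /under_first[xa | [z pxz za]].
    by apply: IH; move: pxy; rewrite xa pab => -[<-].
  by apply: IH; move: pxy; rewrite pxz => -[<-].
have /under_first[ra | [y]] := back a (reach a) (under_refl p a); last by rewrite pr.
by move: pr; rewrite ra pab.
Qed.

Lemma rooted_anti p r x y : rooted p r -> under p x y -> under p y x -> x = y.
Proof.
move=> pr /under_first[// | [z pxz zy] yx].
by have /negP[] := rooted_acyclic pr pxz; apply: under_trans yx.
Qed.

Lemma rooted_unique p r x : rooted p r -> p x = None -> x = r.
Proof. by case=> _ reach px; case: (under_first (reach x)) => // -[y]; rewrite px. Qed.

End ParentFunctions.

(** * Search trees without recursion *)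

Section Characterization.

Variables (V : finType) (e : rel V).
Hypothesis e_sym : symmetric e.
Implicit Types (p : parent_fun V) (S C : {set V}) (a b r u v x y z w : V).

Definition spans_edges p := forall x y, e x y -> under p x y || under p y x.

Definition attached p := forall u w, p w = Some u -> exists2 x, under p x w & e u x.

(** These conditions say that [p] is a search tree with root [r], see
    [search_rootedP].  By [attached] each subtree is connected; by [spans_edges]
    no edge joins the subtrees of two children of a vertex.  Hence these
    subtrees are the connected components that the recursion asks for. *)
Definition search_rooted p r := [/\ rooted p r, spans_edges p & attached p].

Definition connected S := forall x y, x \in S -> y \in S -> connect (induced e S) x y.

Lemma inducedE S x y : induced e S x y = [&& x \in S, y \in S & e x y].
Proof. by []. Qed.

Lemma induced_sym S : symmetric (induced e S).
Proof.
by move=> x y; apply/and3P/and3P => -[? ? ?]; split=> //; rewrite e_sym.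
Qed.

Lemma induced_sub S S' : S \subset S' ->
  subrel (connect (induced e S)) (connect (induced e S')).
Proof.
move=> /subsetP sSS'; apply: connect_sub => x y /and3P[xS yS exy].
by apply: connect1; rewrite inducedE !sSS'.
Qed.

(** Points reachable from [x] inside [S] are reachable from [x] inside the
    component of [x], since the whole path lies there. *)
Lemma connected_component S C : C \in components e S -> connected C.
Proof.
case/imsetP=> x xS ->; set D := [set y in S | _].
have D_x y : y \in D -> connect (induced e D) x y.
  rewrite inE => /andP[_ /connectP[s]].
  have: x \in D by rewrite inE xS connect0.
  elim: s x {xS} @D => [|z s IHs] x D xD /=; first by move=> _ ->; rewrite connect0.
  case/andP=> xz sP def_y; have /and3P[xS zS exz] := xz.
  have eqD : D = [set y in S | connect (induced e S) z y].
    apply/setP=> t; rewrite !inE; congr (_ && _).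
    exact: (same_connect1 (sym_connect_sym (induced_sym S)) xz t).
  have zD : z \in D by rewrite inE zS connect1.
  apply: (connect_trans (y := z)); first by apply: connect1; rewrite inducedE xD zD.
  by rewrite eqD; apply: IHs; rewrite -?eqD.
move=> y z /D_x xy /D_x xz; apply: connect_trans xz.
by rewrite (sym_connect_sym (induced_sym D)).
Qed.

Lemma component_sub S C : C \in components e S -> C \subset S.
Proof. by case/imsetP=> x _ ->; apply/subsetP=> y; rewrite inE => /andP[]. Qed.

Lemma component_closed S C x y :
  C \in components e S -> x \in C -> y \in S -> e x y -> y \in C.
Proof.
case/imsetP=> z _ -> /[!inE] /andP[xS zx] yS exy; rewrite yS.
by apply: (connect_trans zx); apply: connect1; rewrite inducedE xS yS.
Qed.

Lemma component_exists S x : x \in S -> exists2 C, C \in components e S & x \in C.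
Proof.
move=> xS; exists [set y in S | connect (induced e S) x y].
  exact: imset_f.
by rewrite inE xS connect0.
Qed.

(** In a connected set, the first time a path from [C] to [r] leaves [C], it
    must step on [r]. *)
Lemma component_attached S r C :
  connected S -> r \in S -> C \in components e (S :\ r) -> exists2 x, x \in C & e r x.
Proof.
move=> cS rS CP; have [x xSr defC] := imsetP CP; have xC : x \in C.
  by rewrite defC inE xSr connect0.
have /subsetP sCS := component_sub CP.
have /setD1P[_ xS] := xSr.
have /connectP[s] := cS x r xS rS.
elim: s x xC {defC xS xSr} => [|y s IHs] x xC /=.
  by move=> _ def_r; move: (sCS _ xC); rewrite -def_r !inE eqxx.
case/andP=> /and3P[xS yS exy] sP def_r.
have [yr | yr] := eqVneq y r; first by exists x; rewrite // -yr e_sym.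
by apply: (IHs y); rewrite // (component_closed CP xC) // !inE yr.
Qed.

(** The three conditions of [search_rooted], relative to [S].  They are proved
    together, by induction on the fuel; [component_attached] gives the third
    one for the children of [r]. *)
Lemma search_tree_on_sound p k S r : connected S -> search_tree_on e p k S r ->
  [/\ forall x, x \in S -> under p x r,
      forall x y, x \in S -> y \in S -> e x y -> under p x y || under p y x &
      forall u w, w \in S :\ r -> p w = Some u -> exists2 x, under p x w & e u x].
Proof.
elim: k S r => // k IHk S r cS /= /andP[rS /forall_inP subP].
have {subP} sub C : C \in components e (S :\ r) ->
    exists c, [/\ p c = Some r, forall x, x \in C -> under p x c,
      forall x y, x \in C -> y \in C -> e x y -> under p x y || under p y x &
      forall u w, w \in C -> p w = Some u -> exists2 x, under p x w & e u x].
  move=> CP; have /existsP[c /andP[/eqP pc cP]] := subP C CP.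
  have [Cc eC aC] := IHk C c (connected_component CP) cP.
  exists c; split=> // u w wC pw; have [wc | wc] := eqVneq w c.
    have [x xC erx] := component_attached cS rS CP.
    by move: pw; rewrite wc pc => -[<-]; exists x; first exact: Cc.
  by apply: aC; rewrite // !inE wc.
have under_r x : x \in S -> under p x r.
  move=> xS; have [-> | xr] := eqVneq x r; first exact: under_refl.
  have /component_exists[C CP xC] : x \in S :\ r by rewrite !inE xr.
  have [c [pc Cc _ _]] := sub C CP.
  exact: under_trans (Cc x xC) (under_parent pc).
split=> // [x y xS yS exy | u w wS pw].
  have [-> | xr] := eqVneq x r; first by rewrite under_r ?orbT.
  have [-> | yr] := eqVneq y r; first by rewrite under_r.
  have /component_exists[C CP xC] : x \in S :\ r by rewrite !inE xr.
  have [c [_ _ eC _]] := sub C CP; apply: eC => //.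
  by rewrite (component_closed CP xC) // !inE yr.
have [C CP wC] := component_exists wS; have [c [_ _ _ aC]] := sub C CP.
exact: aC.
Qed.

(** No edge joins the subtree of the child [c] of [u] to another child's
    subtree, so one leaves the subtree of [c], inside that of [u], only
    through [u]. *)
Lemma search_rooted_subtree p r u c x y :
    search_rooted p r -> p c = Some u -> under p x c -> e x y -> under p y u ->
  y != u -> under p y c.
Proof.
case=> pr eP _ pc xc exy yu neq_yu.
have /orP[xy|yx] := eP x y exy; last exact: under_trans yx xc.
have /orP[|//] := under_linear xc xy.
case/under_first=> [-> | [u']]; first exact: under_refl.
rewrite pc => -[<-] uy; by rewrite (rooted_anti pr yu uy) eqxx in neq_yu.
Qed.

(** The subtree of [c] is made of [c] and of the subtrees of its children, which
    are connected by induction and contain a neighbour of [c]. *)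
Lemma subtree_connected p r c x : search_rooted p r -> under p x c ->
  connect (induced e (subtree p c)) c x.
Proof.
case=> pr eP aP; have [m] := ubnP #|subtree p c|.
elim: m c x => // m IHm c x /ltnSE lt_m /under_last[-> | [z pz xz]].
  exact: connect0.
have sub_zc : subtree p z \subset subtree p c.
  apply/subsetP=> t; rewrite !mem_subtree => tz.
  exact: under_trans tz (under_parent pz).
have lt_z : #|subtree p z| < m.
  apply: leq_trans lt_m; apply: proper_card; rewrite properE sub_zc /=.
  apply/subsetPn; exists c; rewrite mem_subtree ?under_refl //.
  exact: rooted_acyclic pr pz.
have [t tz ect] := aP _ _ pz.
apply: (connect_trans (y := t)).
  apply: connect1; rewrite inducedE !mem_subtree under_refl ect andbT /=.
  exact: under_trans tz (under_parent pz).
apply: (induced_sub sub_zc); apply: connect_trans (IHm z x lt_z xz).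
by rewrite (sym_connect_sym (induced_sym _)); exact: IHm.
Qed.

(** The components left by removing [w] from its subtree are the subtrees of its
    children: these are connected, and closed under adjacency. *)
Lemma search_rooted_complete p r : search_rooted p r ->
  search_tree_on e p #|V| [set: V] r.
Proof.
move=> srp; have [pr eP aP] := srp; have [p_r reach] := pr.
suff main k w : #|subtree p w| <= k -> search_tree_on e p k (subtree p w) w.
  have <-: subtree p r = [set: V] by apply/setP=> x; rewrite mem_subtree reach inE.
  exact/main/max_card.
elim: k w => [|k IHk] w.
  by rewrite leqn0 cards_eq0 => /eqP/setP/(_ w); rewrite mem_subtree under_refl inE.
move=> le_k /=; rewrite mem_subtree under_refl; apply/forall_inP=> C.
case/imsetP=> x /setD1P[xw]; rewrite mem_subtree => xuw ->{C}.
have [/eqP|[c pc xc]] := under_last xuw; first by rewrite (negPf xw).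
have cw : ~~ under p w c by exact: rooted_acyclic pr pc.
have sub_c : subtree p c \subset subtree p w :\ w.
  apply/subsetP=> t; rewrite !(mem_subtree, inE) => tc.
  rewrite [X in _ && X](under_trans tc (under_parent pc)) andbT.
  by apply: contraNneq cw => <-.
apply/existsP; exists c; rewrite pc eqxx /=.
suff ->: [set y in subtree p w :\ w |
    connect (induced e (subtree p w :\ w)) x y] = subtree p c.
  apply: IHk; rewrite -ltnS; apply: leq_trans le_k.
  apply: leq_ltn_trans (subset_leq_card sub_c) _.
  by rewrite [X in _ < X](cardsD1 w) mem_subtree under_refl.
apply/setP=> y; rewrite inE mem_subtree; apply/andP/idP => [[_ /connectP[s]]|yc].
  elim: s x {xw xuw} xc => [|z s IHs] x xc /=; first by move=> _ ->.
  case/andP=> /and3P[_]; rewrite !(mem_subtree, inE) => /andP[zw zuw] exz.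
  by apply: IHs; apply: (search_rooted_subtree srp pc xc exz).
split; first by apply: (subsetP sub_c); rewrite mem_subtree.
apply: (induced_sub sub_c); apply: connect_trans (subtree_connected srp yc).
by rewrite (sym_connect_sym (induced_sym _)); apply: (subtree_connected srp xc).
Qed.

Hypothesis e_conn : forall x y, connect e x y.

Lemma search_rootedP p r :
  search_rooted p r <-> is_search_tree e p /\ p r = None.
Proof.
have sound r' : p r' = None -> search_tree_on e p #|V| [set: V] r' -> search_rooted p r'.
  move=> pr' /search_tree_on_sound[x y _ _|reach eP aP].
    rewrite (eq_connect (e' := e)) // => ? ?; by rewrite inducedE !inE.
  have rooted_r' : rooted p r' by split=> // x; apply: reach.
  split=> // [x y|u w pw]; first exact: eP.
  apply: aP => //; rewrite !inE andbT; by apply: contra_eq_neq pw => ->; rewrite pr'.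
split=> [srp | [/existsP[r' /andP[/eqP pr' /(sound _ pr') srp]] pr]].
  have [[pr _] _ _] := srp; split=> //.
  by apply/existsP; exists r; rewrite pr eqxx search_rooted_complete.
by have [rp _ _] := srp; rewrite (rooted_unique rp pr).
Qed.

(** * Rotations *)

Section Rotation.
Variables (p : parent_fun V) (r u v : V).
Hypotheses (srp : search_rooted p r) (pv : p v = Some u) (ur : u != r).
Let q := rotate e p u v.

Let pr : rooted p r. Proof. by case: srp. Qed.

Let neq_uv : u != v.
Proof. by apply: contraNneq (rooted_acyclic pr pv) => ->; apply: under_refl. Qed.

Let qu : q u = Some v.
Proof. by rewrite ffunE (negPf neq_uv) eqxx. Qed.

Let qv : q v = p u.
Proof. by rewrite ffunE eqxx. Qed.

Let q_other x : x != u -> x != v -> p x != Some v -> q x = p x.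
Proof. by rewrite ffunE => /negPf-> /negPf-> /negPf->. Qed.

Let q_child x : p x = Some v -> q x = Some u /\ (exists2 y, under p y x & e u y) \/
    q x = Some v /\ ~ (exists2 y, under p y x & e u y).
Proof.
move=> px; have /negPf xv : x != v.
  by apply: contra_eq_neq px => ->; rewrite pv; apply: contra_neq neq_uv => -[].
have /negPf xu : x != u.
  apply: contraNneq (rooted_acyclic pr pv) => <-; exact: under_parent.
rewrite ffunE xv xu px eqxx /=; case: ifP => [/exists_inP[y yx euy] | xP].
  by left; split=> //; exists y; rewrite // -mem_subtree.
right; split=> // -[y yx euy]; move/exists_inP: xP; apply.
by exists y; rewrite ?mem_subtree.
Qed.

(** A rotation changes the subtrees of [u] and [v] only. *)
Lemma rotate_under_other w x : w != u -> w != v -> under q x w = under p x w.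
Proof.
move=> wu wv; apply/idP/idP; move: x; apply: under_ind => [|x y]; try exact: under_refl.
  have [-> | xu] := eqVneq x u.
    rewrite qu => -[<-] _ /under_first[vw|[u']]; first by rewrite vw eqxx in wv.
    by rewrite pv => -[<-].
  have [-> | xv] := eqVneq x v.
    rewrite qv => pu _; apply: under_trans.
    exact: under_trans (under_parent pv) (under_parent pu).
  have [px | px] := eqVneq (p x) (Some v).
    move=> qx _; apply: under_trans.
    case: (q_child px) => [] [] ; rewrite qx => -[->] _; last exact: under_parent.
    exact: under_trans (under_parent px) (under_parent pv).
  by rewrite q_other // => pxy _; apply: under_trans (under_parent pxy).
have [-> | xu] := eqVneq x u.
  move=> pu _; apply: under_trans; apply: under_trans (under_parent qu) _.
  by apply: under_parent; rewrite qv.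
have [-> | xv] := eqVneq x v.
  rewrite pv => -[<-] _ /under_first[uw|[u']]; first by rewrite uw eqxx in wu.
  by rewrite qu => -[<-].
have [px | px] := eqVneq (p x) (Some v).
  rewrite px => -[<-] _; apply: under_trans.
  case: (q_child px) => [] [qx _]; last exact: under_parent.
  exact: under_trans (under_parent qx) (under_parent qu).
by move=> pxy _; apply: under_trans (under_parent _); rewrite q_other.
Qed.

(** After the rotation [v] takes over the former subtree of [u]. *)
Lemma rotate_under_top x : under p x u -> under q x v.
Proof.
move: x; apply: under_ind => [|x y pxy _]; first exact: under_parent.
have [-> | xu] := eqVneq x u; first by move=> _; apply: under_parent.
have [-> | xv] := eqVneq x v; first by move=> _; apply: under_refl.
have [px | px] := eqVneq (p x) (Some v).
  move=> _; case: (q_child px) => [] [qx _]; last exact: under_parent.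
  exact: under_trans (under_parent qx) (under_parent qu).
by apply: under_trans (under_parent _); rewrite q_other.
Qed.

Lemma rotate_under_bottom x c : under p x c -> q c = Some u -> under q x u.
Proof.
move=> xc qc; have cu : c != u.
  by apply: contra_eq_neq qc => ->; rewrite qu; apply: contra_neq neq_uv => -[].
have cv : c != v.
  apply: contra_eq_neq qc => ->; rewrite qv.
  by apply/eqP => pu; have /negP[] := rooted_acyclic pr pu; apply: under_refl.
apply: under_trans (under_parent qc); by rewrite rotate_under_other.
Qed.

(** An edge between [u] and a vertex below [v] stays comparable because the
    branch that contains it is moved below [u].  As for [attached], [u] is
    attached to its new parent [v] either by the edge [u v] or by a moved
    branch, which contains a neighbour of [v]. *)
Lemma rotate_search_rooted : search_rooted q r.
Proof.
have [_ eP aP] := srp; have [p_r reach] := pr.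
have vr : v != r by apply: contra_eq_neq pv => ->; rewrite p_r.
have edge x y : e x y -> under p x y -> under q x y || under q y x.
  have [-> | yu] := eqVneq y u.
    rewrite e_sym => eux xu; have [-> | [c pc xc]] := under_last xu.
      by rewrite under_refl.
    have [cv | cv] := eqVneq c v; last first.
      rewrite (rotate_under_bottom xc) // q_other //; last first.
        by rewrite pc; apply: contra_neq neq_uv => -[].
      apply: contraNneq (rooted_acyclic pr pc) => ->; exact: under_refl.
    move: xc; rewrite cv => /under_last[-> | [d pd xd]].
      by rewrite (under_parent qu) orbT.
    by case: (q_child pd) => [] [qd]; [rewrite (rotate_under_bottom xd)|case; exists x].
  have [-> | yv] := eqVneq y v.
    move=> _ xv; rewrite rotate_under_top //; exact: under_trans xv (under_parent pv).
  by move=> _ xy; rewrite rotate_under_other ?xy.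
split.
- split; last by move=> x; rewrite rotate_under_other // eq_sym.
  by rewrite q_other ?p_r // eq_sym.
- move=> x y exy; case/orP: (eP _ _ exy) => [/edge | /edge]; first exact.
  by rewrite orbC; apply; rewrite e_sym.
move=> z w; have [-> | wu] := eqVneq w u.
  rewrite qu => -[<-]; have [x xv eux] := aP _ _ pv.
  have [xv' | [c pc xc]] := under_last xv.
    by exists u; rewrite ?under_refl // e_sym -xv'.
  case: (q_child pc) => [] [qc]; last by case; exists x.
  have [y yc evy] := aP _ _ pc; by exists y => //; exact: rotate_under_bottom yc qc.
have [-> | wv] := eqVneq w v.
  rewrite qv => /aP[x xu ezx]; exists x => //; exact: rotate_under_top.
have [pw | pw] := eqVneq (p w) (Some v); last first.
  by rewrite q_other // => /aP[x xw ezx]; exists x; rewrite // rotate_under_other.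
case: (q_child pw) => [] [-> xP] [<-].
  by case: xP => x xw; exists x => //; rewrite rotate_under_other.
have [x xw evx] := aP _ _ pw; by exists x; rewrite // rotate_under_other.
Qed.

End Rotation.

(** The rotation makes [v] the parent of [u]; if the rotation of another edge
    did so as well, then [p] would have a cycle through [u] and [v]. *)
Lemma rotate_inj p r u v u' v' : rooted p r -> p v = Some u -> p v' = Some u' ->
  rotate e p u v = rotate e p u' v' -> v = v'.
Proof.
move=> pr pv pv' /ffunP/(_ u); have acyc := rooted_acyclic pr.
have neq_uv : u != v by apply: contraNneq (acyc _ _ pv) => ->; apply: under_refl.
rewrite !ffunE (negPf neq_uv) eqxx.
have [uv' | _] := eqVneq u v'.
  move=> /esym pu'; have /negP[] := acyc _ _ pv.
  by rewrite uv'; apply: under_trans (under_parent pv') (under_parent pu').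
have [_ [] // | _] := eqVneq u u'.
case: ifP => [/andP[/eqP pu _] [vu'] | _ /esym pu]; have /negP[] := acyc _ _ pv.
  by apply: under_trans (under_parent pu) _; rewrite vu'; apply: under_parent.
exact: under_parent.
Qed.

End Characterization.

(** * Vertices that do not disconnect the graph *)

Section NonCut.

Variables (V : finType) (e : rel V).
Hypotheses (e_sym : symmetric e) (e_conn : forall x y, connect e x y).
Implicit Types (p q : parent_fun V) (a b c r u v w x y z : V) (s t : seq V).

Definition noncut a := connected e [set~ a].

(** An order in which the graph can be dismantled one vertex at a time, keeping
    the remaining graph connected: each vertex but the last has a later
    neighbour. *)
Fixpoint peeling s : bool :=
  if s is x :: s' then (s' == [::]) || [&& x \notin s', has (e x) s' & peeling s']
  else true.

Lemma peeling_uniq s : peeling s -> uniq s.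
Proof. by elim: s => //= x s IHs /orP[/eqP->|/and3P[-> _ /IHs]]. Qed.

(** Read backwards, the order grows a connected set from [x]; as the graph is
    connected, the growth stops only when all vertices are taken. *)
Lemma peeling_exists x :
  exists s, peeling (rcons s x) /\ forall y, y \in rcons s x.
Proof.
suff main k : k < #|V| -> exists s, peeling (rcons s x) /\ size s = k.
  have V0 : 0 < #|V| by apply/card_gt0P; exists x.
  have [|s [sP size_s]] := main #|V|.-1; first by rewrite prednK.
  exists s; split=> // y; have: rcons s x =i V.
    apply/subset_cardP; last exact: subset_predT.
    by rewrite (card_uniqP (peeling_uniq sP)) size_rcons size_s prednK.
  by move->.
elim: k => [_ | k IHk lt_k]; first by exists [::].
have [s [sP size_s]] := IHk (ltnW lt_k).
suff /existsP[y /andP[ys es]] : [exists y, (y \notin rcons s x) && has (e y) (rcons s x)].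
  by exists (y :: s); rewrite /= size_s ys es sP orbT.
apply: contraLR lt_k; rewrite negb_exists => /forallP closed_s; rewrite -leqNgt.
have in_s y : y \in rcons s x.
  have [t] := connectP (e_conn x y).
  have: x \in rcons s x by rewrite mem_rcons mem_head.
  elim: t {1 3 4}x => [|z t IHt] x' x's /=; first by move=> _ ->.
  case/andP=> exz; apply: IHt.
  have := closed_s z; rewrite negb_and negbK => /orP[// | /hasPn/(_ x' x's)].
  by rewrite e_sym exz.
by rewrite -size_s -(size_rcons s x) cardT uniq_leq_size ?enum_uniq.
Qed.

Lemma peeling_connected s : peeling s -> connected e [set x in s].
Proof.
elim: s => [_ x y|x s IHs /= /orP[/eqP-> | /and3P[_ /hasP[z zs exz] /IHs cs]]].
- by rewrite inE.
- by move=> y z; rewrite !inE => /eqP-> /eqP->.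
have from_x y : y \in x :: s -> connect (induced e [set y in x :: s]) x y.
  rewrite inE => /predU1P[-> // | ys]; apply: (connect_trans (y := z)).
    by apply: connect1; rewrite inducedE !inE eqxx zs exz orbT.
  apply: (@induced_sub _ _ [set y in s]); last by apply: cs; rewrite inE.
  by apply/subsetP=> y'; rewrite !inE => ->; rewrite orbT.
move=> y y'; rewrite !inE -!in_cons => ys y's.
apply: connect_trans (from_x y' y's).
by rewrite (sym_connect_sym (induced_sym e_sym _)) from_x.
Qed.

Lemma peeling_noncut a s :
  peeling (a :: s) -> (forall x, x \in a :: s) -> noncut a.
Proof.
move=> sP all_s; rewrite /noncut; have /andP[a_s _] := peeling_uniq sP.
have <-: [set x in s] = [set~ a].
  apply/setP=> x; rewrite !inE; have := all_s x; rewrite inE.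
  by have [-> _ | _ /= ->] := eqVneq x a; first exact: negPf.
apply: peeling_connected; move: sP => /= /orP[/eqP-> | /and3P[]] //.
Qed.

Lemma peeling_neighbor x0 s i : peeling s -> i.+1 < size s ->
  exists2 j, i < j < size s & e (nth x0 s i) (nth x0 s j).
Proof.
elim: s i => // x s IHs [|i] /= /orP[/eqP-> // | /and3P[_ has_s sP]] lt_i.
  have /hasP[y ys exy] := has_s; exists (index y s).+1.
    by rewrite /= ltnS index_mem.
  by rewrite /= nth_index.
have [j /andP[ij js] ejs] := IHs i sP lt_i.
by exists j.+1 => //; apply/andP.
Qed.

(** Reading the order as a path, with each vertex the parent of the next, gives
    a search tree: any two vertices are comparable, and a later neighbour lies
    in the subtree. *)
Lemma peeling_search_rooted a s :
  peeling (a :: s) -> (forall x, x \in a :: s) -> exists p, search_rooted e p a.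
Proof.
set l := a :: s => lP all_l.
pose p : parent_fun V :=
  [ffun x => if index x l is i.+1 then Some (nth a l i) else None].
have uniq_l := peeling_uniq lP.
have under_p i j : i <= j -> j < size l -> under p (nth a l j) (nth a l i).
  move=> le_ij; rewrite -(subnK le_ij); elim: (j - i) => [|k IHk] lt_l.
    by rewrite under_refl.
  apply: under_trans (IHk (ltnW lt_l)); apply: under_parent.
  by rewrite ffunE index_uniq.
have under_index x y : index y l <= index x l -> under p x y.
  by move=> /under_p; rewrite index_mem all_l !nth_index //; apply.
exists p; split.
- split; first by rewrite ffunE /= eqxx.
  by move=> x; apply: under_index; rewrite /= eqxx.
- move=> x y _; have /orP[] := leq_total (index x l) (index y l) => /under_index -> //.
  by rewrite orbT.
move=> u w; rewrite ffunE; case def_i: (index w l) => [//|i] [<-].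
have lt_i : i.+1 < size l by rewrite -def_i index_mem all_l.
have [j /andP[ij jl] ej] := peeling_neighbor a lP lt_i.
by exists (nth a l j) => //; apply: under_index; rewrite def_i index_uniq.
Qed.

(** The first vertex of a peeling order is not a cut vertex.  Since the last one
    can be prescribed, two distinct noncut vertices are found by using this
    twice. *)
Lemma noncut_search_rooted x : 1 < #|V| -> exists a,
  [/\ a != x, noncut a & exists p, search_rooted e p a].
Proof.
move=> V1; have [[|a s] [sP all_s]] := peeling_exists x.
  have /card_gt1P[y [z [_ _ /eqP[]]]] := V1.
  by have:= all_s y; have:= all_s z; rewrite !inE => /eqP-> /eqP->.
rewrite rcons_cons in sP all_s; exists a; split.
- have /= := peeling_uniq sP.
  by rewrite mem_rcons inE negb_or => /andP[/andP[]].
- exact: peeling_noncut sP all_s.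
exact: peeling_search_rooted sP all_s.
Qed.

(** A path between two children of the root that avoids the root cannot leave
    the subtree in which it starts. *)
Lemma noncut_child p a w w' : search_rooted e p a -> noncut a ->
  p w = Some a -> p w' = Some a -> w = w'.
Proof.
move=> srp cut_a pw pw'; have [rp _ _] := srp; have [pa reach] := rp.
have not_a x : p x = Some a -> x \in [set~ a].
  by move=> px; rewrite !inE; apply: contra_eq_neq px => ->; rewrite pa.
suff /under_first[-> // | [z]] : under p w' w.
  rewrite pw' => -[<-] aw; have := rooted_acyclic rp pw; by rewrite aw.
have [t] := connectP (cut_a w w' (not_a w pw) (not_a w' pw')).
elim: t {1 3 4}w (under_refl p w) => [|y t IHt] x xw /=; first by move=> _ ->.
case/andP=> /and3P[_]; rewrite !inE => ya exy; apply: IHt.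
exact: (search_rooted_subtree srp pw xw exy).
Qed.

(** The tree [p] with the names of [a] and [b] exchanged. *)
Definition swap a b p : parent_fun V := [ffun x => omap (tperm a b) (p (tperm a b x))].

Lemma swapK a b : involutive (swap a b).
Proof.
move=> p; apply/ffunP=> x; rewrite !ffunE tpermK.
by case: (p x) => //= y; rewrite tpermK.
Qed.

Lemma swapC a b : swap a b =1 swap b a.
Proof. by move=> p; apply/ffunP=> x; rewrite !ffunE tpermC. Qed.

(** The root changes only when the edge from the root [a] to its child is
    rotated, so [u = a] and [v = b].  As [a] is then the only child of [b], all
    other branches below [b] must have moved to [a]: the rotation exchanges
    the two names. *)
Lemma rotate_noncut_swap p a b u v :
    a != b -> noncut a -> noncut b -> search_rooted e p a ->
    search_rooted e (rotate e p u v) b -> p v = Some u ->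
  rotate e p u v = swap a b p.
Proof.
move=> ab cut_a cut_b srp srq pv; have [rp _ _] := srp; have [[qb _] _ _] := srq.
have [pa _] := rp.
have bv : b = v.
  apply/eqP; move: qb; rewrite ffunE; case: eqP => // _.
  do 2![case: ifP => // _]; move/(rooted_unique rp) => ba.
  by rewrite ba eqxx in ab.
have ua : u = a by move: qb; rewrite ffunE bv eqxx; apply: rooted_unique.
rewrite {}ua -{v}bv in pv qb srq *; have /negPf ba : b != a by rewrite eq_sym.
have qa : rotate e p a b a = Some b by rewrite ffunE (negPf ab) eqxx.
apply/ffunP=> x; rewrite [RHS]ffunE.
case: tpermP => [-> | -> | xa xb].
- by rewrite qa pv /= tpermL.
- by rewrite qb pa.
have: rotate e p a b x != Some b.
  by apply/eqP => qx; apply: xa; apply: noncut_child srq cut_b qx qa.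
rewrite ffunE; move/eqP/negPf: xa => ->; move/eqP: (xb) => /negPf->.
have [-> /= | pxb] := eqVneq (p x) (Some b).
  by rewrite tpermR; case: ifP; rewrite ?eqxx.
case px: (p x) => [y|] //= _; congr Some; rewrite tpermD //.
  by apply/eqP=> ay; apply: xb; apply: noncut_child srp cut_a _ pv; rewrite px ay.
by move: pxb; rewrite px; apply: contra => /eqP->.
Qed.

End NonCut.

(** * Degrees between search trees with prescribed roots *)

Section Counting.

Variables (V : finType) (e : rel V).
Hypotheses (e_sym : symmetric e) (e_conn : forall x y, connect e x y).
Implicit Types (T : search_tree e) (a b : V).

Definition rooted_at a : {set search_tree e} := [set T : search_tree e | val T a == None].

Lemma rooted_atP T a : reflect (search_rooted e (val T) a) (T \in rooted_at a).
Proof.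
rewrite inE; apply: (iffP eqP) => [Ta | /(search_rootedP e_sym e_conn)[]//].
by apply/(search_rootedP e_sym e_conn); split=> //; apply: valP.
Qed.

Lemma rotation_graph_sym : symmetric (rotation_graph e).
Proof. by move=> T T'; rewrite /rotation_graph /= orbC. Qed.

Lemma disjoint_rooted_at a b : a != b -> [disjoint rooted_at a & rooted_at b].
Proof.
move=> ab; rewrite disjoint_subset; apply/subsetP=> T /rooted_atP[ra _ _].
by rewrite !inE; apply: contra ab => /eqP/(rooted_unique ra)->.
Qed.

(** Rotations that keep [a] as the root: one for each vertex other than [a] and
    the only child of [a]. *)
Lemma inner_degree a T : noncut e a -> T \in rooted_at a ->
  #|V|.-2 <= #|[set T' in rooted_at a | rotation_graph e T T']|.
Proof.
move=> cut_a /rooted_atP srT; have [rT _ _] := srT.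
(* The lower ends of the edges whose rotation keeps the root. *)
pose D := [set v | (val T v != None) && (val T v != Some a)].
(* The default values are not reached on [D]. *)
pose rot v := insubd T (rotate e (val T) (odflt a (val T v)) v).
have rotP v : v \in D -> exists u,
    [/\ val T v = Some u, u != a & val (rot v) = rotate e (val T) u v].
  rewrite inE /rot; case Tv: (val T v) => [u|] //= ua; exists u.
  have {}ua : u != a by apply: contra ua => /eqP->.
  split=> //; rewrite val_insubd.
  have := rotate_search_rooted e_sym srT Tv ua.
  by case/(search_rootedP e_sym e_conn) => ->.
have rot_inj : {in D &, injective rot}.
  move=> v v' /rotP[u [Tv _ rv]] /rotP[u' [Tv' _ rv']] /(congr1 val).
  by rewrite rv rv'; apply: rotate_inj rT Tv Tv'.
apply: (@leq_trans #|D|); last first.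
  rewrite -(card_in_imset rot_inj); apply/subset_leq_card/subsetP=> _ /imsetP[v vD ->].
  have [u [Tv ua rv]] := rotP v vD; rewrite inE; apply/andP; split.
    apply/rooted_atP; rewrite rv; exact: rotate_search_rooted.
  apply/orP; left; apply/existsP; exists u; apply/existsP; exists v.
  by rewrite Tv rv !eqxx.
rewrite -(cardsC D) -subn2 leq_subLR [leqRHS]addnC leq_add2l.
have sub : ~: D \subset a |: [set v | val T v == Some a].
  apply/subsetP=> v; rewrite !inE negb_and !negbK => /orP[/eqP/(rooted_unique rT)-> | ->].
    by rewrite eqxx.
  by rewrite orbT.
apply: leq_trans (subset_leq_card sub) _; apply: leq_trans (leq_card_setU _ _) _.
rewrite cards1 add1n ltnS; apply/card_le1_eqP => v v'; rewrite !inE => /eqP pv /eqP pv'.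
exact: noncut_child srT cut_a pv' pv.
Qed.

(** Since [swap] is an involution, a rotation in either direction between roots
    [a] and [b] leads to the same tree, namely the swapped one. *)
Lemma cross_degree a b T : a != b -> noncut e a -> noncut e b -> T \in rooted_at a ->
  #|[set T' in rooted_at b | rotation_graph e T T']| <= 1.
Proof.
move=> ab cut_a cut_b /rooted_atP srT; have ba : b != a by rewrite eq_sym.
suff swapT T' : T' \in [set T' in rooted_at b | rotation_graph e T T'] ->
    val T' = swap a b (val T).
  by apply/card_le1_eqP => T1 T2 /swapT E1 /swapT E2; apply: val_inj; rewrite E1.
rewrite inE => /andP[/rooted_atP srT' /orP[]];
  case/existsP=> u /existsP[v /andP[/eqP pv /eqP def]].
  by rewrite def; apply: rotate_noncut_swap => //; rewrite -def.
apply: (can_inj (swapK a b)); rewrite swapK swapC.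
by rewrite [in RHS]def; apply/esym/rotate_noncut_swap => //; rewrite -def.
Qed.

End Counting.

(** * Courant-Fischer *)

Local Open Scope ring_scope.
Local Open Scope sesquilinear_scope.

(** Fewer linear conditions than unknowns. *)
Lemma low_rank_null_vector (F : fieldType) (k n : nat) (I : finType)
    (h : I -> 'I_n) (M : 'M[F]_(k, n)) : (#|I| < k)%N ->
  exists2 w : 'rV_k, w != 0 & forall i, (w *m M) 0 (h i) = 0.
Proof.
move=> lt_k; pose M' := \matrix_(l < k, j < #|I|) M l (h (enum_val j)).
have /rowV0Pn[w /sub_kermxP wM w0] : kermx M' != 0.
  rewrite -mxrank_eq0 mxrank_ker subn_eq0 -ltnNge.
  exact: leq_ltn_trans (rank_leq_col _) lt_k.
exists w => // i; have /rowP/(_ (enum_rank i)) := wM.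
rewrite !mxE => wM_i; rewrite -[RHS]wM_i; apply: eq_bigr => l _.
by rewrite !mxE enum_rankK.
Qed.

(** The eigenvalues are sorted, so from index [k] on they are all below [c].  If
    [k] is out of bounds, then the [k]-th item is the default 0, but the list is
    too short for the bound to fail. *)
Lemma count_eigenvalues_ge (R : rcfType) (n : nat) (A : 'M[R]_n) (c : R) (k : nat) :
  A^T = A -> (eigenvalues A)`_k < c ->
  (count [pred x | (c <= x)%R] (eigenvalues A) <= k)%N.
Proof.
move=> /eigenvaluesP[]; set s := eigenvalues A => s_sorted _ lt_c.
rewrite -(cat_take_drop k s) count_cat -[leqRHS]addn0; apply: leq_add.
  by apply: leq_trans (count_size _ _) _; rewrite size_take_min geq_minl.
rewrite leqNgt -has_count; apply/hasPn=> x /(nthP 0)[j].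
rewrite size_drop nth_drop => lt_j <- /=; rewrite -ltNge; apply: le_lt_trans lt_c.
have lt_kj : (k + j < size s)%N by rewrite -ltn_subRL.
have ge_trans : transitive (>=%R : rel R) by move=> x1 x2 x3 /[swap]; apply: le_trans.
apply: (sorted_leq_nth ge_trans _ _ s_sorted); rewrite ?inE ?leq_addr //.
  by move=> x1; apply: lexx.
exact: leq_ltn_trans (leq_addr j k) lt_kj.
Qed.

Section ComplexForms.

Variable R : rcfType.
Local Notation f := (real_complex R).

Lemma conj_real_complex (x : R) : (f x)^* = f x.
Proof. by apply/CrealP; rewrite complex_real. Qed.

(** Writing [w = x + 'i y] with real [x] and [y], the cross terms cancel by
    symmetry and the form is the sum of its values at [x] and [y]. *)
Lemma complex_nonneg_form (m : nat) (M : 'M[R]_m) :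
    M^T = M -> (forall w : 'rV_m, 0 <= (w *m M *m w^T) 0 0) ->
  forall w : 'rV[R[i]]_m, 0 <= (w *m map_mx f M *m w^t*) 0 0.
Proof.
move=> symM posM w.
pose x := map_mx (@complex.Re R) w; pose y := map_mx (@complex.Im R) w.
have wE : w = map_mx f x + 'i *: map_mx f y.
  by apply/rowP=> j; rewrite !mxE [LHS]complexE.
have wtE : w^t* = map_mx f x^T - 'i *: map_mx f y^T.
  apply/matrixP=> i j; rewrite {1}wE !mxE rmorphD rmorphM /= conjCi !conj_real_complex.
  by rewrite mulNr.
have cross : y *m M *m x^T = x *m M *m y^T.
  have <-: (y *m M *m x^T)^T = x *m M *m y^T by rewrite !trmx_mul trmxK symM mulmxA.
  by apply/matrixP=> i j; rewrite !ord1 [RHS]mxE.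
rewrite wtE wE mulmxDl mulmxDl !mulmxBr -!scalemxAl -!scalemxAr -!map_mxM cross.
rewrite scalerA -expr2 sqrCi scaleN1r opprK addrA subrK -map_mxD mxE ler0c mxE.
by rewrite addr_ge0 ?posM.
Qed.

(** The real spectral theorem, with a complex change of basis; it links the
    sorted list of eigenvalues to a diagonalization. *)
Lemma spectral_eigenvalues (n : nat) (A : 'M[R]_n) : A^T = A ->
  exists P : 'M[R[i]]_n, exists2 d : 'rV[R]_n,
    [/\ P \is unitarymx & map_mx f A = P^t* *m diag_mx (map_mx f d) *m P] &
    perm_eq [seq d 0 i | i <- enum 'I_n] (eigenvalues A).
Proof.
move=> Asym; pose B := map_mx f A.
have Bherm : B \is hermsymmx.
  apply/is_hermitianmxP; rewrite expr0 scale1r; apply/matrixP => i j.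
  by rewrite !mxE -[in LHS]Asym mxE conj_real_complex.
have /orthomx_spectralP Bspec := hermitian_normalmx Bherm.
pose d : 'rV_n := map_mx (@complex.Re R) (spectral_diag B).
have dE : spectral_diag B = map_mx f d.
  apply/rowP=> i; rewrite !mxE.
  have /mxOverP/(_ 0 i)/complex_realP[x ->] := hermitian_spectral_diag_real Bherm.
  by [].
have cpA : char_poly A = \prod_(i < n) ('X - (d 0 i)%:P).
  apply: (map_poly_inj f); rewrite map_char_poly -/B {1}Bspec.
  rewrite char_poly_conj ?spectral_unit // char_poly_trig; last exact/diag_mx_is_trig.
  rewrite rmorph_prod; apply: eq_bigr => i _.
  by rewrite dE !mxE eqxx mulr1n rmorphB /= map_polyX map_polyC.
exists (spectralmx B), d.
  by rewrite -dE -(invmx_unitary (spectral_unitarymx B)) spectral_unitarymx.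
apply/allP=> x _ /=; rewrite count_eigenvalues cpA.
rewrite -big_enum -(big_map (fun i => d 0 i) xpredT (fun z => 'X - z%:P)) /=.
by rewrite mu_prod_XsubC.
Qed.

(** Only the lower bound, by dimension count.  If fewer than [k + 1] eigenvalues
    were at least [c], some nonzero vector of the row space of [U] would have
    no component along their eigenvectors, so that its Rayleigh quotient would
    be less than [c].  The eigenvectors at hand are complex, whence the passage
    to complex combinations of the rows of [U]. *)
Theorem courant_fischer (n k : nat) (A : 'M[R]_n) (U : 'M[R]_(k.+1, n)) (c : R) :
    A^T = A -> row_free U ->
    (forall w : 'rV_k.+1,
       c * (w *m U *m (w *m U)^T) 0 0 <= (w *m U *m A *m (w *m U)^T) 0 0) ->
  c <= (eigenvalues A)`_k.
Proof.
move=> symA freeU formU; rewrite leNgt; apply/negP => lt_c.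
have [P [d [Punit BE] perm_d]] := spectral_eigenvalues symA.
pose I : finType := {i : 'I_n | c <= d 0 i}.
have cardI : (#|I| < k.+1)%N.
  rewrite ltnS card_sig; apply: leq_trans (count_eigenvalues_ge symA lt_c).
  by rewrite -(seq.permP perm_d) count_map -size_filter cardE enumT {1}/enum_mem.
have [w w0 wI] := low_rank_null_vector (fun i : I => val i) (map_mx f U *m P^t*) cardI.
case/eqP: w0.
(* The hypothesis says that this symmetric matrix is nonnegative. *)
pose M := U *m (A - c%:M) *m U^T.
have symM : M^T = M.
  by rewrite /M !trmx_mul trmxK linearB /= symA tr_scalar_mx mulmxA.
have posM (v : 'rV_k.+1) : 0 <= (v *m M *m v^T) 0 0.
  have := formU v; rewrite -subr_ge0; congr (_ <= _).
  rewrite /M !mulmxA -(mulmxA _ U^T) -trmx_mul mulmxBr mulmxBl mul_mx_scalar -scalemxAl.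
  by rewrite !mxE.
(* Coordinates, in the eigenbasis, of the vector chosen in the row space. *)
pose y := w *m (map_mx f U *m P^t*).
have PtP : P^t* *m P = 1%:M by apply: mulmx1C; apply/unitarymxP.
have shiftE : map_mx f (A - c%:M) =
    P^t* *m diag_mx (map_mx f (d - const_mx c)) *m P.
  rewrite map_mxB BE map_scalar_mx map_mxB map_const_mx linearB /= diag_const_mx.
  by rewrite mulmxBr mulmxBl mul_mx_scalar -scalemxAl PtP scalemx1.
have ytE : y^t* = P *m (map_mx f U^T *m w^t*).
  rewrite /y !trmx_mul !map_mxM /= trmxCK mulmxA; congr (_ *m _ *m _).
  by apply/matrixP=> i j; rewrite !mxE conj_real_complex.
have form_y : (w *m map_mx f M *m w^t*) 0 0 = \sum_j f (d 0 j - c) * `|y 0 j| ^+ 2.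
  have ->: w *m map_mx f M *m w^t* = y *m diag_mx (map_mx f (d - const_mx c)) *m y^t*.
    by rewrite ytE /y /M !map_mxM shiftE !mulmxA.
  rewrite mul_mx_diag mxE; apply: eq_bigr => j _.
  by rewrite !mxE normCK mulrAC mulrC.
have term_le0 j : f (d 0 j - c) * `|y 0 j| ^+ 2 <= 0.
  have [cd | dc] := leP c (d 0 j).
    by rewrite (wI (exist _ j cd)) normr0 expr0n mulr0.
  by rewrite mulr_le0_ge0 ?exprn_ge0 // lecR subr_le0 ltW.
have y0 : y = 0.
  have := complex_nonneg_form symM posM w; rewrite form_y => sum_ge0.
  have: \sum_j - (f (d 0 j - c) * `|y 0 j| ^+ 2) == 0.
    rewrite sumrN oppr_eq0 eq_le sum_ge0 andbT; exact: sumr_le0.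
  rewrite psumr_eq0 => [/allP sum0 | j _]; last by rewrite oppr_ge0.
  apply/rowP=> j; rewrite [RHS]mxE.
  have [cd | dc] := leP c (d 0 j); first exact: (wI (exist _ j cd)).
  have /= := sum0 j (mem_index_enum j); rewrite oppr_eq0 mulf_eq0 expf_eq0 normr_eq0.
  by rewrite fmorph_eq0 subr_eq0 lt_eqF //= => /eqP.
have : w *m map_mx f U = 0.
  have := congr1 (mulmxr P) y0; rewrite /= mul0mx -mulmxA -(mulmxA _ _ P) PtP mulmx1.
  by [].
by move/eqP; rewrite mulmx_free_eq0 ?row_free_map // => /eqP.
Qed.

End ComplexForms.

(** * Two weakly linked dense sets in a graph *)

Section Clusters.
Variables (R : rcfType) (T : finType) (g : rel T) (X Y : {set T}) (m l : nat).
Hypotheses (g_sym : symmetric g) (disjXY : [disjoint X & Y]).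
Hypotheses (innerX : forall t, t \in X -> (m <= #|[set t' in X | g t t']|)%N)
           (innerY : forall t, t \in Y -> (m <= #|[set t' in Y | g t t']|)%N)
           (crossX : forall t, t \in X -> (#|[set t' in Y | g t t']| <= l)%N)
           (crossY : forall t, t \in Y -> (#|[set t' in X | g t t']| <= l)%N).

(** Each edge contributes a product of two values taken in the set of [a], [b]
    and 0.  Such a product [x t * x t'] is at least the average of the squares,
    multiplied by 1, -1 or 0 according to the sides of [t] and [t'].  Summing
    over edges, each [x t ^+ 2] with [t] in [X] or [Y] receives its inner degree
    minus its cross degree. *)
Lemma cluster_form (a b : R) (x : T -> R) :
    (forall t, x t = a * (t \in X)%:R + b * (t \in Y)%:R) ->
  (m%:R - l%:R) * \sum_t x t * x t <= \sum_t \sum_t' x t * (g t t')%:R * x t'.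
Proof.
move=> xE; pose eps t : R := (t \in X)%:R - (t \in Y)%:R.
(* The sign of the edge: 1 inside a side, -1 across, 0 elsewhere. *)
pose h t t' := eps t * (g t t')%:R * eps t'.
have side t : [\/ [/\ x t = a, eps t = 1 & t \in X], [/\ x t = b, eps t = -1 & t \in Y] |
    x t = 0 /\ eps t = 0].
  rewrite xE /eps; have [tX | tX] := boolP (t \in X).
    by rewrite (disjointFr disjXY tX) mulr1 mulr0 addr0 subr0; constructor 1.
  have [tY | tY] := boolP (t \in Y).
    by rewrite mulr0 add0r mulr1 sub0r; constructor 2.
  by rewrite !mulr0 addr0 subr0; constructor 3.
have pointwise t t' :
    h t t' * (x t * x t) + h t t' * (x t' * x t') <= 2%:R * (x t * (g t t')%:R * x t').
  have sq := sqr_ge0 (a + b); rewrite /h.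
  case: (g t t'); last by rewrite !(mulr0, mul0r) addr0.
  rewrite !mulr1.
  by case: (side t) => [[-> -> _] | [-> -> _] | [-> ->]];
     case: (side t') => [[-> -> _] | [-> -> _] | [-> ->]]; nra.
have row t : (m%:R - l%:R) * (x t * x t) <= \sum_t' h t t' * (x t * x t).
  have count_sum (Z : {set T}) :
      \sum_t' (g t t')%:R * (t' \in Z)%:R = #|[set t' in Z | g t t']|%:R :> R.
    rewrite -sum1_card natr_sum [RHS]big_mkcond; apply: eq_bigr => t' _.
    by rewrite inE; case: (g t t'); case: (t' \in Z); rewrite ?mulr0 ?mulr1.
  rewrite -mulr_suml; have ->: \sum_t' h t t' =
      eps t * (#|[set t' in X | g t t']|%:R - #|[set t' in Y | g t t']|%:R).
    rewrite -!count_sum -sumrB mulr_sumr; apply: eq_bigr => t' _.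
    by rewrite /h -mulrA mulrBr.
  case: (side t) => [[_ -> tX] | [_ -> tY] | [-> ->]]; last by rewrite !mulr0.
    rewrite mul1r ler_wpM2r -?expr2 ?sqr_ge0 //.
    by apply: lerB; rewrite ler_nat ?innerX ?crossX.
  rewrite mulN1r opprB ler_wpM2r -?expr2 ?sqr_ge0 //.
  by apply: lerB; rewrite ler_nat ?innerY ?crossY.
have h_sym t t' : h t t' = h t' t by rewrite /h g_sym; ring.
rewrite -(ler_pM2l (ltr0n R 2)).
apply: (@le_trans _ _ (\sum_t \sum_t' (h t t' * (x t * x t) + h t t' * (x t' * x t')))).
  have -> : \sum_t \sum_t' (h t t' * (x t * x t) + h t t' * (x t' * x t')) =
      \sum_t \sum_t' h t t' * (x t * x t) + \sum_t \sum_t' h t t' * (x t * x t).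
    rewrite [X in _ = _ + X]exchange_big -big_split; apply: eq_bigr => t _ /=.
    by rewrite -big_split; apply: eq_bigr => t' _; rewrite /= [h t' t]h_sym.
  rewrite -mulr2n -[leRHS]mulr_natl ler_pM2l ?ltr0n // mulr_sumr; exact: ler_sum.
by rewrite mulr_sumr; apply: ler_sum => t _; rewrite mulr_sumr; apply: ler_sum.
Qed.

(** The indicators of [X] and [Y] are independent as the sets are disjoint and
    nonempty; the bound holds on the plane that they span. *)
Lemma clusters_second_eigenvalue : X != set0 -> Y != set0 ->
  m%:R - l%:R <= (eigenvalues (adjacency_mx R g))`_1.
Proof.
case/set0Pn=> tX XtX /set0Pn[tY YtY].
have YtX : tX \in Y = false := disjointFr disjXY XtX.
have XtY : tY \in X = false := disjointFl disjXY YtY.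
pose U : 'M[R]_(2, #|T|) := \matrix_(i, j) (enum_val j \in if i == 0 then X else Y)%:R.
have wU (w : 'rV_2) j :
    (w *m U) 0 j = w 0 0 * (enum_val j \in X)%:R + w 0 1 * (enum_val j \in Y)%:R.
  rewrite mxE !big_ord_recl big_ord0 addr0 !mxE /=.
  by congr (_ + w 0 _ * _); apply: val_inj.
apply: (@courant_fischer R _ 1 _ U).
- by apply/matrixP=> i j; rewrite !mxE g_sym.
- rewrite -kermx_eq0; apply/rowV0P=> w /sub_kermxP/rowP w0.
  have w0X := w0 (enum_rank tX); have w0Y := w0 (enum_rank tY).
  move: w0X w0Y; rewrite !wU !mxE !enum_rankK XtX YtX XtY YtY.
  rewrite !mulr0 !mulr1 addr0 add0r => w00 w01.
  apply/rowP=> -[[|[|//]] lt_i]; rewrite mxE; [rewrite -[RHS]w00 | rewrite -[RHS]w01];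
    congr (w 0 _); exact: val_inj.
move=> w; pose x t := w 0 0 * (t \in X)%:R + w 0 1 * (t \in Y)%:R.
have -> : (w *m U *m (w *m U)^T) 0 0 = \sum_t x t * x t.
  rewrite mxE [RHS](big_enum_val (A := T)) /=; apply: eq_bigr => j _.
  by rewrite [_^T _ _]mxE !wU.
have -> : (w *m U *m adjacency_mx R g *m (w *m U)^T) 0 0 =
    \sum_t \sum_t' x t * (g t t')%:R * x t'.
  rewrite mxE exchange_big /= [RHS](big_enum_val (A := T)) /=; apply: eq_bigr => j _.
  rewrite [_^T _ _]mxE mxE wU mulr_suml [RHS](big_enum_val (A := T)).
  apply: eq_bigr => i _.
  by rewrite wU mxE.
exact: cluster_form.
Qed.

End Clusters.

(** * The spectral gap of rotation graphs *)

Theorem theorem2 (R : rcfType) (V : finType) (e : rel V) (n : nat)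
    (e_sym : symmetric e) (e_irr : irreflexive e)
    (e_conn : forall x y : V, connect e x y)
    (card_V : #|V| = n.+1) (n_ge2 : (2 <= n)%N) :
  n%:R - 2%:R <= (eigenvalues (adjacency_mx R (rotation_graph e)))`_1.
Proof.
have V_gt1 : (1 < #|V|)%N by rewrite card_V ltnS ltnW.
have /card_gt0P[x _] := ltnW V_gt1.
have [a [_ cut_a [p p_a]]] := noncut_search_rooted e_sym e_conn x V_gt1.
have [b [ba cut_b [q q_b]]] := noncut_search_rooted e_sym e_conn a V_gt1.
have ab : a != b by rewrite eq_sym.
have rooted_at_neq0 c r : search_rooted e r c -> rooted_at e c != set0.
  case/(search_rootedP e_sym e_conn) => treeP r_c.
  by apply/set0Pn; exists (exist _ r treeP); rewrite inE /= r_c.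
have -> : n%:R - 2%:R = n.-1%:R - 1%:R :> R.
  by rewrite -subn1 natrB ?(ltnW n_ge2) // -addrA -opprD -natrD.
have inner c T := @inner_degree V e e_sym e_conn c T.
rewrite card_V /= in inner.
apply: (@clusters_second_eigenvalue R _ _ (rooted_at e a) (rooted_at e b)).
- exact: rotation_graph_sym.
- exact: disjoint_rooted_at.
- by move=> T; apply: inner.
- by move=> T; apply: inner.
- by move=> T; apply: cross_degree.
- by move=> T; apply: cross_degree.
- exact: rooted_at_neq0 p_a.
exact: rooted_at_neq0 q_b.
Qed.
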